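(* Let $d,k\in\mathbb{N}$ with $2\le k\le d$. Then $$\mathrm{MNV}(d,k)=\min\Big(0,\ \min_{i=k,\ldots,d}(-1)^{d-i}\binom{d-k}{i-k}\big(\gamma_i^{(k)}\big)^{-1}\Big).$$ Moreover, let $i_0\in\{k,\ldots,d\}$ be such that $$\mathrm{MNV}(d,k)=(-1)^{d-i_0}\binom{d-k}{i_0-k}\big(\gamma_{i_0}^{(k)}\big)^{-1}.$$ Put $$a=1-\frac{\alpha_{i_0}^{(k)}}{\gamma_{i_0}^{(k)}},\qquad \mathcal B=[a,1]^d,$$ and define $q_0,\ldots,q_d$ by $$q_i=\begin{cases}0,& i=0,\ldots,i_0-1,\\ \big(\gamma_{i_0}^{(k)}\big)^{-1},& i=i_0,\\ \sum_{j=1}^{k}\binom{k}{j}(-1)^{j+1}q_{i-j},& i=i_0+1,\ldots,d.\end{cases}$$ Then there exists a $k$-increasing $d$-variate quasi-copula $Q:[0,1]^d\to[0,1]$ such that $Q(z)=q_{d-S(z)}$ for every $z\in\{a,1\}^d$, where $S(z)$ is the number of coordinates of $z$ equal to $a$, and such that $V_Q(\mathcal B)=\mathrm{MNV}(d,k)$.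
   Context: For a $d$-box $\mathcal B=\prod_{i=1}^d[a_i,b_i]\subseteq[0,1]^d$ and a function $F$ defined on it, the $F$-volume is $V_F(\mathcal B)=\sum_{z}(-1)^{S(z)}F(z)$, the sum being over the $2^d$ vertices $z$ of $\mathcal B$ and $S(z)=\operatorname{card}\{j: z_j=a_j\}$ (degenerate boxes have volume $0$). A function of $d$ variables is $d$-increasing if $V_F(\mathcal B)\ge0$ for every $d$-box $\mathcal B$ in its domain. A $d$-variate quasi-copula ($d\ge2$) is a function $Q:[0,1]^d\to[0,1]$ such that: $Q(u)=0$ whenever some coordinate $u_i=0$; $Q(1,\ldots,1,u_i,1,\ldots,1)=u_i$ for every $i$; $Q$ is nondecreasing in each variable; and $|Q(u)-Q(v)|\le\sum_{i=1}^d|u_i-v_i|$ for all $u,v\in[0,1]^d$. For a function $F$ on a box $\mathcal B=\prod_{j=1}^d[x_j,y_j]$, a $k$-section of $F$ is the function of $k$ variables obtained by fixing the coordinates $z_j=a_j\in[x_j,y_j]$ for $j\notin A$ and letting $z_j\in[x_j,y_j]$ vary for $j\in A$, where $A\subseteq\{1,\ldots,d\}$ has $k$ elements. $F$ is $k$-increasing ($1\le k\le d$) if each of its $k$-sections is $k$-increasing as a function of $k$ variables (i.e. all volumes of $k$-boxes in its domain are $\ge 0$). $\mathrm{MNV}(d,k)$ denotes the maximal negative volume (the negative volume largest in absolute value), i.e. the minimum of $V_Q(\mathcal B)$ over all $d$-boxes $\mathcal B\subseteq[0,1]^d$ and all $k$-increasing $d$-variate quasi-copulas $Q$ (it is $0$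 if no negative volume occurs). The numbers $\gamma_i^{(j)},\alpha_i^{(j)}$ (for $j=2,\ldots,k$, $i=2,\ldots,d$) are defined recursively by: - $\gamma_i^{(2)}=d+1-i$ and $\alpha_i^{(2)}=1$ for $i=2,\ldots,d$; - for $j=3,\ldots,k$: $\gamma_i^{(j)}=\gamma_i^{(j-1)}$ and $\alpha_i^{(j)}=\alpha_i^{(j-1)}$ for $i=2,\ldots,j-2$; - for $j=3,\ldots,k$: $\gamma_i^{(j)}=\sum_{\ell=i}^d\gamma_\ell^{(j-1)}$ and $\alpha_i^{(j)}=\sum_{\ell=i}^d\alpha_\ell^{(j-1)}$ for $i=j-1,\ldots,d$. *)

(* Defs.v *)
From HB Require Import structures.
From mathcomp Require Import all_boot all_order all_algebra.
From mathcomp Require Import all_classical all_reals.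

Set Implicit Arguments.
Unset Strict Implicit.
Unset Printing Implicit Defensive.

Import Order.TTheory GRing.Theory Num.Theory.

Local Open Scope ring_scope.
Local Open Scope classical_set_scope.

(* Points have coordinates indexed by an arbitrary finite type, so that a
   function of d variables (index type 'I_d) and its sections (index type
   {j | j \in A}) are instances of the same notion. Functions on a box are
   represented by total functions of which only the values on the box are
   constrained. *)
Section Boxes.
Context {R : realType} {I : finType}.
Implicit Types (x y a b u : I -> R) (F : (I -> R) -> R).

Definition in_box x y u : Prop := forall i, x i <= u i <= y i.

(* [a, b] is a (possibly degenerate) box contained in [x, y]. *)
Definition subbox x y a b : Prop :=
  forall i, [&& x i <= a i, a i <= b i & b i <= y i].

(* The vertex of [a, b] whose coordinates in S are the lower endpoints. *)
Definition vertex a b (S : {set I}) : I -> R :=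
  fun i => if i \in S then a i else b i.

(* Vertices are indexed by the set of their lower coordinates: #|S| is S(z)
   when a i < b i for all i, and the sum cancels to 0 on degenerate boxes. *)
Definition volume F a b : R :=
  \sum_(S : {set I}) (-1) ^+ #|S| * F (vertex a b S).

(* n-increasing for n = #|I|, as a function on the box [x, y]. *)
Definition fully_increasing x y F : Prop :=
  forall a b, subbox x y a b -> 0 <= volume F a b.

End Boxes.

Section Sections.
Context {R : realType} {I : finType}.
Implicit Types (x y c : I -> R) (F : (I -> R) -> R).

(* The section of F with free coordinates in A and with the coordinates
   outside A fixed to those of c. *)
Definition glue (A : {set I}) c (w : {j | j \in A} -> R) : I -> R :=
  fun j => if insub j is Some j' then w j' else c j.

Definition section F (A : {set I}) c : ({j | j \in A} -> R) -> R :=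
  fun w => F (glue c w).

Definition k_increasing (k : nat) x y F : Prop :=
  forall (A : {set I}) c, #|A| = k ->
    (forall j, j \notin A -> x j <= c j <= y j) ->
    fully_increasing (fun j : {j | j \in A} => x (val j))
                     (fun j : {j | j \in A} => y (val j))
                     (section F c).

End Sections.

Section QuasiCopulas.
Variables (R : realType) (d : nat).
Implicit Types (u v a b : 'I_d -> R) (Q : ('I_d -> R) -> R).

Definition cube0 (_ : 'I_d) : R := 0.
Definition cube1 (_ : 'I_d) : R := 1.
Definition in_cube u : Prop := in_box cube0 cube1 u.

Record quasi_copula Q : Prop := QuasiCopula {
  qc_range : forall u, in_cube u -> 0 <= Q u <= 1;
  qc_grounded : forall u, in_cube u -> (exists i, u i = 0) -> Q u = 0;
  qc_margin : forall (i : 'I_d) (t : R), 0 <= t <= 1 ->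
    Q (fun j => if j == i then t else 1) = t;
  qc_nondecreasing : forall u v (i : 'I_d), in_cube u -> in_cube v ->
    (forall j, j != i -> u j = v j) -> u i <= v i -> Q u <= Q v;
  qc_lipschitz : forall u v, in_cube u -> in_cube v ->
    `|Q u - Q v| <= \sum_(i < d) `|u i - v i| }.

(* All volumes of boxes in the unit cube; 0 occurs through degenerate boxes. *)
Definition kqc_volumes (k : nat) : set R :=
  [set m | exists Q a b, [/\ quasi_copula Q, k_increasing k cube0 cube1 Q,
                             subbox cube0 cube1 a b & m = volume Q a b]].

Definition MNV (k : nat) : R := inf (kqc_volumes k).

End QuasiCopulas.

Arguments cube0 : clear implicits.
Arguments cube1 : clear implicits.
Arguments kqc_volumes : clear implicits.
Arguments MNV : clear implicits.

Definition is_minimum (R : realType) (E : set R) (m : R) : Prop :=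
  E m /\ lbound E m.

(* The common recursion in the upper index j >= 2 for gamma and alpha, which
   differ only by the values at j = 2; the values at j < 2 or i < 2 are junk. *)
Fixpoint tail_sums (d : nat) (init : nat -> nat) (j i : nat) : nat :=
  if j is j'.+1 then
    if (j <= 2)%N then init i
    else if (i <= j - 2)%N then tail_sums d init j' i
    else (\sum_(i <= l < d.+1) tail_sums d init j' l)%N
  else init i.

Definition gamma (d j i : nat) : nat := tail_sums d (fun i => d.+1 - i)%N j i.
Definition alpha (d j i : nat) : nat := tail_sums d (fun=> 1%N) j i.

Definition mnv_term (R : realType) (d k i : nat) : R :=
  (-1) ^+ (d - i) * 'C(d - k, i - k)%:R * (gamma d k i)%:R^-1.

(* The values q_0, ..., q_d; subtraction is never truncated when k <= i0. *)
Definition is_vertex_values (R : realType) (d k i0 : nat) (q : nat -> R) : Prop :=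
  [/\ forall i, (i < i0)%N -> q i = 0,
      q i0 = (gamma d k i0)%:R^-1 &
      forall i, (i0 < i <= d)%N ->
        q i = \sum_(1 <= j < k.+1) 'C(k, j)%:R * (-1) ^+ j.+1 * q (i - j)%N].

(* Main.v *)
(* Let q_i be the average of Q over the vertices of the box with i upper
   coordinates. Then V_Q is the d-th difference of q at 0, i.e. L((X-1)^d) for the
   functional L : X^i -> q_i, and k-increasingness (with groundedness) says
   L((X-1)^j X^s) >= 0 for j <= k. Expanding (X-1)^d = (X-1)^k (X-1)^(d-k) writes
   V_Q as an alternating combination of the numbers p_i = L((X-1)^k X^(i-k)) >= 0,
   while Taylor's formula for X^d at 1 gives sum_i gamma_i p_i <= q_d <= 1; hence
   V_Q is bounded below by the least of 0 and the values at the vertices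
   p_i = 1/gamma_i of this simplex.
   Conversely, for p supported at i0, the function u |-> L(prod_i (m(u_i) +
   h(u_i)(X-1))) with m(t) = min(t/a, 1) and h(t) = max(0, (t-a)/(1-a)), which
   interpolates multilinearly the values q on the grid {0, a, 1}^d, is k-increasing
   because every k-section volume is a nonnegative combination of
   L((X-1)^j X^s) with j <= k. *)
Require Import Defs.
From HB Require Import structures.
From mathcomp Require Import all_boot all_order all_fingroup all_algebra.
From mathcomp Require Import all_classical all_reals.
From mathcomp Require Import ring zify.

Set Implicit Arguments.
Unset Strict Implicit.
Unset Printing Implicit Defensive.

Import Order.TTheory GRing.Theory Num.Theory.

Local Open Scope ring_scope.
Local Open Scope classical_set_scope.

(** * Finite differences as values of a linear functional on polynomials *)

Section Umbral.
Variable (R : realType).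
Implicit Types (q : nat -> R) (p : {poly R}).

(* The linear functional sending 'X^i to q i; thus umbral q (('X - 1) ^+ j * 'X^s)
   is the j-th forward difference of q at s. *)
Definition umbral q p : R := \sum_(i < size p) p`_i * q i.

Lemma umbral_widen q p n : (size p <= n)%N -> umbral q p = \sum_(i < n) p`_i * q i.
Proof.
move=> pn; rewrite /umbral (big_ord_widen n (fun i => p`_i * q i) pn).
rewrite [RHS](bigID (fun i : 'I_n => (i < size p)%N)) /=.
rewrite [X in _ = _ + X]big1 ?addr0// => i.
by rewrite -leqNgt => /leq_sizeP->//; rewrite mul0r.
Qed.

Fact umbral_linear q : linear (umbral q : {poly R} -> R^o).
Proof.
move=> c p p'; set n := maxn (size p) (size p').
have size_lt (r : {poly R}) : (size r <= n)%N -> umbral q r = \sum_(i < n) r`_i * q i.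
  exact: umbral_widen.
rewrite !size_lt ?leq_maxl ?leq_maxr//; last first.
  rewrite (leq_trans (size_polyD _ _))// geq_max leq_maxr andbT.
  by rewrite (leq_trans (size_scale_leq _ _))// leq_maxl.
rewrite scaler_sumr -big_split; apply: eq_bigr => i _ /=.
by rewrite coefD coefZ mulrDl /GRing.scale/= mulrA.
Qed.

HB.instance Definition _ q :=
  GRing.isLinear.Build R {poly R} R^o _ (umbral q) (umbral_linear q).

Lemma umbralZ q c p : umbral q (c *: p) = c * umbral q p.
Proof. exact: linearZ. Qed.

Lemma umbralXn q n : umbral q 'X^n = q n.
Proof.
rewrite (@umbral_widen _ _ n.+1) ?size_polyXn// big_ord_recr /= big1 ?add0r.
  by rewrite coefXn eqxx mul1r.
by move=> i _; rewrite coefXn ltn_eqF// mul0r.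
Qed.

Lemma umbral_XsubC q j s :
  umbral q (('X - 1) ^+ j.+1 * 'X^s) =
  umbral q (('X - 1) ^+ j * 'X^(s.+1)) - umbral q (('X - 1) ^+ j * 'X^s).
Proof. by rewrite -linearB; congr umbral; rewrite exprSr [in RHS]exprS; ring. Qed.

Lemma umbral_binomial q p n : umbral q (p * ('X - 1) ^+ n) =
  \sum_(i < n.+1) (-1) ^+ i * 'C(n, i)%:R * umbral q (p * 'X^(n - i)).
Proof.
rewrite exprBn mulr_sumr linear_sum; apply: eq_bigr => i _ /=.
rewrite expr1n mulr1 -umbralZ; congr umbral.
rewrite -mulr_natl scalerAr; congr (_ * _).
rewrite -mul_polyC polyCM !rmorphXn/= polyCN rmorph_nat.
by ring.
Qed.

End Umbral.

(** * Nonnegativity of the functional on products of linear factors *)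

Section Cone.
Variables (R : realType) (q : nat -> R) (k : nat).
Implicit Types (p : {poly R}) (b c : R).

(* n counts the factors 'X - 1 that p may already contain, out of k. *)
Definition cone n p := forall j s, (j + n <= k)%N ->
  0 <= umbral q (('X - 1) ^+ j * 'X^s * p).

Definition node b c : {poly R} := b%:P + c *: ('X - 1).

Lemma nodeB b c b' c' : node b c - node b' c' = node (b - b') (c - c').
Proof. by rewrite /node polyCB scalerBl; ring. Qed.

Lemma node00 : node 0 0 = 0. Proof. by rewrite /node scale0r addr0. Qed.

Lemma node11 : node 1 1 = 'X. Proof. by rewrite /node scale1r; ring. Qed.

Lemma node10 : node 1 0 = 1. Proof. by rewrite /node scale0r addr0. Qed.

Lemma cone_ge0 n p : (n <= k)%N -> cone n p -> 0 <= umbral q p.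
Proof. by move=> nk /(_ 0%N 0%N nk); rewrite !expr0 !mul1r. Qed.

Lemma cone0 n : cone n 0. Proof. by move=> j s _; rewrite mulr0 linear0. Qed.

Lemma coneD n p p' : cone n p -> cone n p' -> cone n (p + p').
Proof. by move=> Hp Hp' j s jk; rewrite mulrDr linearD addr_ge0 ?Hp ?Hp'. Qed.

(** In the basis [1], ['X] the factor has nonnegative coefficients [b - c] and [c], and multiplying
    by ['X] only raises [s], so no difference is used up. *)
Lemma coneM_node n b c p : 0 <= c <= b -> cone n p -> cone n (node b c * p).
Proof.
move=> /andP[c0 cb] Hp j s jk.
have -> : ('X - 1) ^+ j * 'X^s * (node b c * p) =
    (b - c) *: (('X - 1) ^+ j * 'X^s * p) + c *: (('X - 1) ^+ j * 'X^(s.+1) * p).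
  by rewrite /node -!mul_polyC polyCB exprS; ring.
by rewrite linearD /= !umbralZ addr_ge0// mulr_ge0 ?Hp ?subr_ge0.
Qed.

(** Now the expansion is in [1] and ['X - 1], whose coefficients are [b] and [c]; the ['X - 1] uses
    up one of the [k] available differences. *)
Lemma coneM_difference n b c p : 0 <= b -> 0 <= c -> cone n p ->
  cone n.+1 (node b c * p).
Proof.
move=> b0 c0 Hp j s jk.
have -> : ('X - 1) ^+ j * 'X^s * (node b c * p) =
    b *: (('X - 1) ^+ j * 'X^s * p) + c *: (('X - 1) ^+ j.+1 * 'X^s * p).
  by rewrite /node -!mul_polyC exprS; ring.
rewrite linearD /= !umbralZ addr_ge0// mulr_ge0 ?Hp//; lia.
Qed.

Lemma cone_prod_node I (r : seq I) (P : pred I) (b c : I -> R) n p :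
  (forall i, P i -> 0 <= c i <= b i) -> cone n p ->
  cone n (p * \prod_(i <- r | P i) node (b i) (c i)).
Proof.
move=> bc Hp; elim/big_rec: _ => [|i x Pi IH]; first by rewrite mulr1.
by rewrite mulrCA; apply: coneM_node => //; apply: bc.
Qed.

Lemma cone_prod_difference (I : finType) (A : {pred I}) (b c : I -> R) p :
  {in A, forall i, 0 <= b i} -> {in A, forall i, 0 <= c i} -> cone 0 p ->
  cone #|A| (p * \prod_(i in A) node (b i) (c i)).
Proof.
move=> b0 c0 Hp; rewrite cardE -big_enum/=.
have: {subset enum A <= A} by move=> i; rewrite mem_enum.
elim: (enum A) => [|i r IH] rA; first by rewrite big_nil mulr1.
have iA : i \in A by apply: rA; rewrite mem_head.
rewrite big_cons mulrCA; apply: coneM_difference; rewrite ?b0 ?c0//.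
by apply: IH => j jr; apply: rA; rewrite in_cons jr orbT.
Qed.

(** Exchanging the factors one at a time telescopes: every summand contains a single
    ['X - node b c = node (1 - b) (1 - c)], so one difference is enough whatever the number of
    factors. *)
Lemma cone_Xn_sub_prod I (r : seq I) (P : pred I) (b c : I -> R) : cone 0 1 ->
  (forall i, P i -> [&& 0 <= c i, c i <= b i & b i <= 1]) ->
  cone 1 (\prod_(i <- r | P i) 'X - \prod_(i <- r | P i) node (b i) (c i)).
Proof.
move=> H1 bc; rewrite -[\prod_(i <- r | P i) node _ _]mul1r.
elim: r => [|i r IH]; first by rewrite !big_nil mulr1 subrr; exact: cone0.
rewrite !big_cons; case: ifP => // Pi.
set A := \prod_(j <- r | P j) 'X in IH *; set B := \prod_(j <- r | P j) _ in IH *.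
have -> : 'X * A - 1 * (node (b i) (c i) * B) =
    node 1 1 * (A - 1 * B) + node (1 - b i) (1 - c i) * (1 * B).
  by rewrite -nodeB node11; ring.
have /and3P[ci0 cb b1] := bc _ Pi.
apply: coneD; first by apply: coneM_node => //; rewrite ler01 lexx.
apply: coneM_difference; rewrite ?subr_ge0//; first exact: le_trans b1.
by apply: cone_prod_node => // j /bc/and3P[-> ->].
Qed.

End Cone.

(** * Quasi-copulas built from a sequence and two coordinate functions *)

Section Blend.
Variables (R : realType) (q : nat -> R) (m h : R -> R).

Definition factor t : {poly R} := node (m t) (h t).

Definition blend (I : finType) (u : I -> R) : R :=
  umbral q (\prod_i factor (u i)).

(** An alternating sum of products over the vertices factors into one difference per coordinate, and
    the functional is linear; [p] carries the coordinates that a section keeps fixed. *)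
Lemma volume_umbral_prod (I : finType) (p : {poly R}) (f : R -> {poly R}) a b :
  volume (fun u : I -> R => umbral q (p * \prod_i f (u i))) a b =
  umbral q (p * \prod_i (f (b i) - f (a i))).
Proof.
under [in RHS]eq_bigr do rewrite addrC.
rewrite bigA_distr mulr_sumr linear_sum; apply: eq_bigr => S _ /=.
rewrite -umbralZ; congr umbral; rewrite scalerAr; congr (_ * _).
rewrite -mul_polyC rmorphXn/= polyCN -prodr_const.
rewrite big_mkcond -big_split/=; apply: eq_bigr => i _.
by rewrite /vertex; case: ifP => _; rewrite ?mulN1r ?mul1r.
Qed.

Lemma volume_blend (I : finType) (a b : I -> R) :
  volume (@blend I) a b =
  umbral q (\prod_i node (m (b i) - m (a i)) (h (b i) - h (a i))).
Proof.
have /= := @volume_umbral_prod I 1 factor a b.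
rewrite mul1r; under [in RHS]eq_bigr do rewrite /factor nodeB.
by move=> <-; apply: eq_bigr => S _; rewrite mul1r.
Qed.

Lemma section_blend (I : finType) (A : {set I}) (c : I -> R)
    (w : {j | j \in A} -> R) :
  section (@blend I) c w =
  umbral q ((\prod_(i in ~: A) factor (c i)) * \prod_j factor (w j)).
Proof.
rewrite /section /blend (bigID (mem A)) [in RHS]mulrC /= big_sub; congr umbral.
congr (_ * _); apply: eq_big => j //=; rewrite ?inE// => jA.
  by rewrite /Defs.glue valK.
by rewrite /Defs.glue; case: (insubP {x | x \in A} j) => // u uA; rewrite uA in jA.
Qed.

Variables (k d : nat).

Hypothesis two_le_k : (2 <= k)%N.
Hypothesis q_cone : cone q k 0 1.
Hypothesis m_homo : forall s t : R, 0 <= s -> s <= t -> t <= 1 -> m s <= m t.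
Hypothesis h_homo : forall s t : R, 0 <= s -> s <= t -> t <= 1 -> h s <= h t.
Hypothesis h_le_m : forall t : R, 0 <= t <= 1 -> h t <= m t.
Hypothesis m0 : m 0 = 0.
Hypothesis h0 : h 0 = 0.
Hypothesis m1 : m 1 = 1.
Hypothesis h1 : h 1 = 1.
Hypothesis q_d : q d = 1.
Hypothesis q_margin : forall t : R, 0 <= t <= 1 -> (m t - h t) * q d.-1 + h t = t.

Lemma factor_bounds t : 0 <= t <= 1 -> [&& 0 <= h t, h t <= m t & m t <= 1].
Proof.
move=> t01; have /andP[t0 t1] := t01.
by rewrite -{1}h0 -m1 h_le_m// h_homo// m_homo.
Qed.

Lemma umbral_margin t : (0 < d)%N -> 0 <= t <= 1 ->
  umbral q (factor t * 'X^(d.-1)) = t.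
Proof.
move=> d0 t01; have -> : factor t * 'X^(d.-1) =
    (m t - h t) *: 'X^(d.-1) + h t *: 'X^(d.-1.+1).
  by rewrite /factor /node -!mul_polyC polyCB exprS; ring.
by rewrite linearD/= !umbralZ !umbralXn prednK// q_d mulr1 q_margin.
Qed.

(** The [k] free coordinates contribute difference factors, costing one ['X - 1] each, and the fixed
    ones cost nothing; this is exactly the number of differences covered by [q_cone]. *)
Lemma k_increasing_blend : k_increasing k (cube0 R d) (cube1 R d) (@blend 'I_d).
Proof.
move=> A c kA cA a b ab; have -> : volume (section (@blend 'I_d) c) a b =
    umbral q ((\prod_(i in ~: A) factor (c i)) *
              \prod_j node (m (b j) - m (a j)) (h (b j) - h (a j))).
  have -> : section (@blend 'I_d) c = fun w : {j | j \in A} -> R =>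
      umbral q ((\prod_(i in ~: A) factor (c i)) * \prod_j factor (w j)).
    by apply: funext => w; exact: section_blend.
  rewrite (volume_umbral_prod _ factor).
  by congr (umbral q (_ * _)); apply: eq_bigr => j _; rewrite /factor nodeB.
have {}ab i : [/\ 0 <= a i, a i <= b i & b i <= 1] by have /and3P := ab i.
apply: (@cone_ge0 _ _ k #|{: {j | j \in A}}|); first by rewrite card_sig kA.
apply: cone_prod_difference => [i _|i _|].
- by rewrite subr_ge0; have [? ? ?] := ab i; apply: m_homo.
- by rewrite subr_ge0; have [? ? ?] := ab i; apply: h_homo.
rewrite -[\prod_(i in _) _]mul1r; apply: cone_prod_node => // i.
by rewrite inE => /cA/factor_bounds/and3P[-> ->].
Qed.

(** The increment in coordinate [i] is nonnegative and grows with the other coordinates; once these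
    are all 1 it equals [v i - u i] by the margins. *)
Lemma blend_step (u v : 'I_d -> R) i : in_cube u -> in_cube v ->
  (forall j, j != i -> u j = v j) -> u i <= v i ->
  0 <= blend v - blend u <= v i - u i.
Proof.
move=> u01 v01 uv uvi; have d0 := leq_ltn_trans (leq0n i) (ltn_ord i).
have /andP[ui0 ui1] := u01 i;
have /andP[vi0 vi1] := v01 i.
pose N := node (m (v i) - m (u i)) (h (v i) - h (u i)).
pose B := \prod_(j | j != i) factor (v j).
have dE : blend v - blend u = umbral q (N * B).
  rewrite -linearB; congr umbral; rewrite (bigD1 i)// [X in _ - X](bigD1 i)//=.
  by rewrite (eq_bigr _ (fun j ji => congr1 factor (uv j ji))) -mulrBl nodeB.
have cardi : #|[pred j : 'I_d | j != i]| = d.-1 by rewrite cardC1 card_ord.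
have XE : 'X^(d.-1) = \prod_(j | j != i) ('X : {poly R}).
  by rewrite prodr_const cardi.
have vi : v i - u i = umbral q (N * 'X^(d.-1)).
  rewrite /N -nodeB mulrBl linearB/= !umbral_margin//; [exact/andP|exact/andP].
have N0 : 0 <= m (v i) - m (u i) by rewrite subr_ge0 m_homo.
have N0' : 0 <= h (v i) - h (u i) by rewrite subr_ge0 h_homo.
rewrite dE; apply/andP; split.
  apply: (@cone_ge0 _ _ k 1); first by lia.
  apply: coneM_difference => //; rewrite -[B]mul1r.
  by apply: cone_prod_node => // j _; have /and3P[-> ->] := factor_bounds (v01 j).
(* [N] uses one difference and the gap between the two products another, which is where [2 <= k]
   enters. *)
rewrite vi -subr_ge0 -linearB -mulrBr; apply: (@cone_ge0 _ _ k 2) => //.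
apply: coneM_difference => //; rewrite XE.
by apply: cone_Xn_sub_prod => // j _; apply: factor_bounds; apply: v01.
Qed.

Lemma blend_lipschitz (u v : 'I_d -> R) : in_cube u -> in_cube v ->
  `|blend u - blend v| <= \sum_i `|u i - v i|.
Proof.
(* The path [w] leads from [v] at [n = 0] to [u] at [n = d], changing one coordinate at a time. *)
move=> u01 v01; pose w n (i : 'I_d) := if (i < n)%N then u i else v i.
have w01 n : in_cube (w n) by rewrite /w => i; case: ifP.
have -> : u = w d by apply: funext => i; rewrite /w ltn_ord.
have -> : v = w 0%N by apply: funext => i; rewrite /w ltn0.
rewrite -(telescope_sumr (fun n => blend (w n)) (leq0n d)) big_mkord.
rewrite (le_trans (ler_norm_sum _ _ _))// ler_sum// => i _.
have eqw j : j != i -> w i j = w i.+1 j.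
  by rewrite -val_eqE /w /= => ji; rewrite ltnS (leq_eqVlt j) (negbTE ji).
have -> : w d i = w i.+1 i by rewrite /w ltnSn ltn_ord.
have -> : w 0%N i = w i i by rewrite /w ltnn ltn0.
have [le|/ltW le] := leP (w i i) (w i.+1 i).
  have /andP[ge0 leB] := blend_step (w01 i) (w01 i.+1) eqw le.
  by rewrite (ger0_norm ge0) ger0_norm ?subr_ge0.
have eqw' j : j != i -> w i.+1 j = w i j by move/eqw.
have /andP[ge0 leB] := blend_step (w01 i.+1) (w01 i) eqw' le.
by rewrite distrC [leRHS]distrC (ger0_norm ge0) ger0_norm ?subr_ge0.
Qed.

Lemma quasi_copula_blend : quasi_copula (@blend 'I_d).
Proof.
split.
- move=> u u01; apply/andP; split.
    apply: (@cone_ge0 _ _ k 0); first by lia.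
    rewrite -[\prod_i _]mul1r; apply: cone_prod_node => // i _.
    by have /and3P[-> ->] := factor_bounds (u01 i).
  have q1 : umbral q (\prod_(i < d) 'X) = 1.
    by rewrite prodr_const card_ord umbralXn.
  rewrite -q1 -subr_ge0 -linearB; apply: (@cone_ge0 _ _ k 1); first by lia.
  by apply: cone_Xn_sub_prod => // i _; apply: factor_bounds; apply: u01.
- move=> u _ [i ui0]; rewrite /blend (bigD1 i)//= /factor ui0 m0 h0 node00.
  by rewrite mul0r linear0.
- move=> i t t01; rewrite /blend (bigD1 i)//= eqxx.
  rewrite (eq_bigr (fun=> 'X)) => [|j /negbTE->]; last first.
    by rewrite /factor m1 h1 node11.
  rewrite prodr_const cardC1 card_ord.
  exact: umbral_margin (leq_ltn_trans (leq0n i) (ltn_ord i)) t01.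
- move=> u v i u01 v01 uv uvi; have /andP[] := blend_step u01 v01 uv uvi.
  by rewrite subr_ge0.
- exact: blend_lipschitz.
Qed.

End Blend.

(** * Binomial closed forms, iterated partial sums and Taylor's formula *)

Lemma sum_bin_tail d m i : (i <= d)%N ->
  (\sum_(i <= l < d.+1) 'C(d - l + m, m) = 'C(d - i + m.+1, m.+1))%N.
Proof.
move=> /subnKC <-; move: (d - i)%N => n; elim: n i => [|n IH] i.
  by rewrite addn0 big_nat1 subnn !add0n !binn.
rewrite big_ltn; last by lia.
rewrite -[in X in (_ + X)%N]addSnnS IH !addKn [in RHS]addnS [in RHS]binS.
by rewrite addnC addSnnS.
Qed.

(** For [j < i] the recursion never takes its frozen branch, so each step sums a full tail and the
    hockey-stick identity raises the order of the binomial by one. The initial order [e] is 1 for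
    gamma and 0 for alpha. *)
Lemma tail_sumsE d init e j i :
  (forall l, (l <= d)%N -> init l = 'C(d - l + e, e)) -> (j < i <= d)%N ->
  tail_sums d init j.+2 i = 'C(d - i + (j + e), j + e).
Proof.
move=> initE; elim: j i => [|j IH] i /andP[ji id]; first exact: initE.
rewrite [LHS]/= ifF; last by lia.
rewrite [LHS](_ : _ = \sum_(i <= l < d.+1) 'C(d - l + (j + e), j + e))%N.
  by rewrite sum_bin_tail.
by apply: eq_big_nat => l il; apply: IH; lia.
Qed.

Lemma gammaE d k i : (1 < k <= i)%N -> (i <= d)%N ->
  gamma d k i = 'C(d - i + k.-1, k.-1).
Proof.
case: k => [|[|k]]// ki id; rewrite /gamma (@tail_sumsE _ _ 1%N) ?addn1//; last by lia.
by move=> l ld; rewrite addn1 bin1 subSn.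
Qed.

Lemma alphaE d k i : (1 < k <= i)%N -> (i <= d)%N ->
  alpha d k i = 'C(d - i + k.-2, k.-2).
Proof.
case: k => [|[|k]]// ki id; rewrite /alpha (@tail_sumsE _ _ 0%N) ?addn0//; last by lia.
by move=> l ld; rewrite bin0.
Qed.

Lemma gamma_gt0 d k i : (1 < k <= i)%N -> (i <= d)%N -> (0 < gamma d k i)%N.
Proof. by move=> ki id; rewrite gammaE// bin_gt0 leq_addl. Qed.

(* [vtx k i0] is the k-fold sequence of partial sums of the indicator of i0. *)
Definition vtx (k i0 i : nat) : nat :=
  if (i0 <= i)%N then 'C((i - i0 + k).-1, i - i0) else 0.

Lemma vtxS k i0 i : vtx k.+1 i0 i.+1 = (vtx k.+1 i0 i + vtx k i0 i.+1)%N.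
Proof.
rewrite /vtx; have [ii|ii|->] := ltngtP i0 i.+1.
- rewrite -ltnS ii subSn//.
  by rewrite !addnS addSn/= binS addnC.
- by rewrite leqNgt (ltn_trans _ ii).
- by rewrite ltnn subnn !bin0.
Qed.

Lemma vtxE k i0 i : (0 < k)%N -> (i0 <= i)%N ->
  vtx k i0 i = 'C(i - i0 + k.-1, k.-1).
Proof.
case: k => // k _ ii; rewrite /vtx ii addnS/= -[RHS]bin_sub ?leq_addl//.
by rewrite addnK.
Qed.

Lemma vtx0 i0 i : vtx 0 i0 i = (i == i0).
Proof.
rewrite /vtx; have [ii|ii|->] := ltngtP i0 i.
- by rewrite addn0 bin_small//; lia.
- by [].
- by rewrite subnn bin0.
Qed.

(** By [vtxS] each difference undoes one partial sum; after all [k] of them only the indicator of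
    [i0] is left. *)
Lemma umbral_vtx (R : realType) (c : R) k i0 q j s :
  (forall i, q i = c * (vtx k i0 i)%:R) -> (j <= k)%N ->
  umbral q (('X - 1) ^+ j * 'X^s) = c * (vtx (k - j) i0 (j + s))%:R.
Proof.
move=> qE; elim: j s => [|j IH] s jk.
  by rewrite mul1r umbralXn qE subn0.
rewrite umbral_XsubC !IH ?(ltnW jk)// -mulrBr addnS addSn.
rewrite -[in LHS](subnSK jk) vtxS natrD; congr (_ * _).
by rewrite addrC addKr.
Qed.

(** Taylor expansion at 1 with a discrete remainder, by induction on [d]: multiplication by ['X]
    acts on the main part through Pascal's rule, and the term of order [k.+1] that leaves the main
    part becomes the [s = 0] term of the remainder. *)
Lemma Xn_taylor (R : comNzRingType) d k : 'X^d =
  \sum_(j < k.+1) ('X - 1) ^+ j *+ 'C(d, j) +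
  \sum_(s < d) (('X - 1) ^+ k.+1 * 'X^s) *+ 'C(d - s.+1, k) :> {poly R}.
Proof.
elim: d => [|d IH].
  by rewrite big_ord0 addr0 big_ord_recl bin0 big1 ?addr0.
have X1 j : ('X - 1 : {poly R}) ^+ j * 'X = ('X - 1) ^+ j.+1 + ('X - 1) ^+ j.
  by rewrite exprSr; ring.
rewrite exprSr {}IH mulrDl !mulr_suml.
rewrite [X in _ = _ + X]big_ord_recl subSS subn0 expr0 mulr1 addrA.
congr (_ + _); last first.
  by apply: eq_bigr => s _; rewrite mulrnAl -mulrA -exprSr subSS.
under eq_bigr do rewrite mulrnAl X1 mulrnDl.
rewrite big_split/= big_ord_recr/= [X in _ + X]big_ord_recl/= [in RHS]big_ord_recl/=.
rewrite !bin0 [LHS]addrAC; congr (_ + _).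
rewrite addrCA; congr (_ + _); rewrite -big_split/=.
by apply: eq_bigr => j _; rewrite -mulrnDr binS addnC.
Qed.

(** * The extremal quasi-copula attached to an index [i0] *)

Section Extremal.
Variables (R : realType) (d k i0 : nat).
Hypotheses (k_gt1 : (1 < k)%N) (k_le_i0 : (k <= i0)%N) (i0_lt_d : (i0 < d)%N).

Let g : R := (gamma d k i0)%:R.
Let a : R := 1 - (alpha d k i0)%:R / g.
Let q i : R := g^-1 * (vtx k i0 i)%:R.

(** [ramp_m] climbs on [0, a] and [ramp_h] on [a, 1], so [factor t] moves linearly from 0 through 1
    to ['X] as [t] passes 0, a and 1; at a vertex of {a, 1}^d the product of factors is a power of
    ['X]. *)
Definition ramp_m (t : R) : R := Num.min (t / a) 1.
Definition ramp_h (t : R) : R := Num.max 0 ((t - a) / (1 - a)).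

Lemma gammaR_gt0 : 0 < g.
Proof. by rewrite ltr0n gamma_gt0 ?k_gt1// ltnW. Qed.

Lemma extremal_q_top : q d = 1.
Proof.
rewrite /q vtxE -?gammaE ?k_gt1 ?(ltnW i0_lt_d)//; last exact: ltnW.
by rewrite mulVf// gt_eqF ?gammaR_gt0.
Qed.

(** The margin condition at (a, 1, ..., 1) forces this equality, which explains the choice of [a].
    It reduces to Pascal's rule, in the form of [gE]. *)
Lemma extremal_q_pred : q d.-1 = a.
Proof.
have gE : (gamma d k i0 = alpha d k i0 + vtx k i0 d.-1)%N.
  rewrite gammaE ?alphaE ?vtxE ?k_gt1 ?k_le_i0 ?(ltnW i0_lt_d)//; [|lia|lia].
  rewrite (_ : d - i0 + k.-1 = (d - i0 + k.-2).+1)%N; last by lia.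
  rewrite (_ : k.-1 = k.-2.+1)%N; last by lia.
  rewrite binS addnC; congr (_ + _)%N; congr 'C(_, _); lia.
have g0 := lt0r_neq0 gammaR_gt0; apply: (mulfI g0).
rewrite /a /q mulVKf// mulrBr mulr1 mulrCA divff// mulr1.
by rewrite /g gE natrD addrAC subrr add0r.
Qed.

Lemma corner_gt0 : 0 < a.
Proof.
rewrite -extremal_q_pred mulr_gt0 ?invr_gt0 ?gammaR_gt0// ltr0n /vtx ifT; last by lia.
by rewrite bin_gt0; lia.
Qed.

Lemma corner_lt1 : a < 1.
Proof.
rewrite ltrBlDr ltrDl divr_gt0 ?gammaR_gt0// ltr0n alphaE ?k_gt1 ?k_le_i0//.
  by rewrite bin_gt0 leq_addl.
exact: ltnW.
Qed.

Let a1_gt0 : 0 < 1 - a. Proof. by rewrite subr_gt0 corner_lt1. Qed.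

Lemma ramp_m_lo t : t <= a -> ramp_m t = t / a.
Proof. by move=> ta; rewrite /ramp_m min_l// ler_pdivrMr ?corner_gt0// mul1r. Qed.

Lemma ramp_m_hi t : a <= t -> ramp_m t = 1.
Proof. by move=> ta; rewrite /ramp_m min_r// ler_pdivlMr ?corner_gt0// mul1r. Qed.

Lemma ramp_h_lo t : t <= a -> ramp_h t = 0.
Proof.
move=> ta; rewrite /ramp_h max_l// mulr_le0_ge0 ?subr_le0//.
by rewrite invr_ge0 ltW.
Qed.

Lemma ramp_h_hi t : a <= t -> ramp_h t = (t - a) / (1 - a).
Proof. by move=> ta; rewrite /ramp_h max_r// divr_ge0 ?subr_ge0// ltW// corner_lt1. Qed.

Definition extremal : ('I_d -> R) -> R := @blend R q ramp_m ramp_h 'I_d.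

Lemma umbral_extremal j s : (j <= k)%N -> umbral q (('X - 1) ^+ j * 'X^s) =
  g^-1 * (vtx (k - j) i0 (j + s))%:R.
Proof. exact: umbral_vtx. Qed.

Lemma extremal_spec : quasi_copula extremal /\
  k_increasing k (cube0 R d) (cube1 R d) extremal.
Proof.
have q_cone : cone q k 0 1.
  move=> j s; rewrite addn0 mulr1 => jk; rewrite umbral_extremal// mulr_ge0//.
  by rewrite invr_ge0 ltW// gammaR_gt0.
have m_homo s t : 0 <= s -> s <= t -> t <= 1 -> ramp_m s <= ramp_m t.
  move=> _ st _; rewrite /ramp_m le_min !ge_min lexx orbT andbT.
  by rewrite ler_pM2r ?invr_gt0 ?corner_gt0// st.
have h_homo s t : 0 <= s -> s <= t -> t <= 1 -> ramp_h s <= ramp_h t.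
  move=> _ st _; rewrite /ramp_h ge_max !le_max lexx/=.
  by rewrite ler_pM2r ?invr_gt0// lerB// orbT.
have h_le_m t : 0 <= t <= 1 -> ramp_h t <= ramp_m t.
  move=> /andP[t0 t1]; have [ta|/ltW ta] := leP t a.
    by rewrite ramp_h_lo// ramp_m_lo// divr_ge0// ltW// corner_gt0.
  by rewrite ramp_h_hi// ramp_m_hi// ler_pdivrMr// mul1r lerB.
have m0 : ramp_m 0 = 0 by rewrite ramp_m_lo ?mul0r// ltW// corner_gt0.
have h0 : ramp_h 0 = 0 by rewrite ramp_h_lo// ltW// corner_gt0.
have m1 : ramp_m 1 = 1 by rewrite ramp_m_hi// ltW// corner_lt1.
have h1 : ramp_h 1 = 1.
  by rewrite ramp_h_hi ?divff ?gt_eqF// ltW// corner_lt1.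
split; last exact: k_increasing_blend.
apply: (@quasi_copula_blend _ _ _ _ k) => //; first exact: extremal_q_top.
move=> t _; rewrite extremal_q_pred; have [ta|/ltW ta] := leP t a.
  by rewrite ramp_h_lo// ramp_m_lo// subr0 addr0 divfK// gt_eqF// corner_gt0.
rewrite ramp_h_hi// ramp_m_hi//.
have : 1 - a != 0 by rewrite gt_eqF.
by move=> ?; field.
Qed.

Lemma extremal_volume : volume extremal (fun=> a) (fun=> 1) = mnv_term R d k i0.
Proof.
rewrite volume_blend.
rewrite (eq_bigr (fun=> 'X - 1)) => [|i _]; last first.
  rewrite !ramp_m_hi ?(ltW corner_lt1)// ramp_h_hi ?(ltW corner_lt1)// ramp_h_lo//.
  by rewrite divff ?gt_eqF// /node !subrr subr0 scale1r add0r.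
rewrite prodr_const card_ord; have kd : (k <= d)%N by lia.
rewrite -{1}(subnKC kd) exprD umbral_binomial.
have lt_i : (d - i0 < (d - k).+1)%N by lia.
(* The [k]-th difference of [q] is supported at [i0], so only the summand of index [d - i0]
   survives. *)
rewrite (bigD1 (Ordinal lt_i))//= big1 ?addr0 => [|i]; last first.
  rewrite -val_eqE/= => ii; rewrite umbral_extremal// subnn vtx0.
  rewrite (_ : (_ == i0) = false) ?mulr0//; apply/negP => /eqP.
  by have := ltn_ord i; move/eqP: ii; lia.
rewrite umbral_extremal// subnn vtx0 (_ : (_ == i0)); last by apply/eqP; lia.
rewrite mulr1 /mnv_term -bin_sub; last by lia.
by congr (_ * _ * _); congr (('C(_, _))%:R); lia.
Qed.

Lemma extremal_vertex (z : 'I_d -> R) : (forall i, z i = a \/ z i = 1) ->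
  extremal z = q (d - #|[set i | z i == a]%SET|)%N.
Proof.
move=> za; rewrite -umbralXn; congr umbral.
rewrite (bigID (fun i => z i == a))/= big1 => [|i /eqP->]; last first.
  by rewrite /factor ramp_h_lo// ramp_m_hi// node10.
rewrite mul1r (eq_bigr (fun=> 'X)) => [|i zi]; last first.
  have [/eqP|->] := za i; first by rewrite (negbTE zi).
  rewrite /factor ramp_h_hi ?ramp_m_hi ?(ltW corner_lt1)// divff ?gt_eqF//.
  by rewrite node11.
rewrite prodr_const; congr ('X^_); have := cardsC [set i | z i == a]%SET.
rewrite card_ord (@eq_card _ (~: _) (fun i => z i != a)) => [dE|i].
  by rewrite -[X in (X - _)%N]dE addKn.
by rewrite !inE.
Qed.

(** For [i > i0] the prescribed recursion is the vanishing of the [k]-th difference at [i - k],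
    solved for its leading value. *)
Lemma vertex_valuesE q' : is_vertex_values d k i0 q' ->
  forall i, (i <= d)%N -> q' i = q i.
Proof.
move=> [q'0 q'g q'S]; elim/ltn_ind => i IH id.
have [ii|ii|->] := ltngtP i i0.
- by rewrite q'0// /q /vtx leqNgt ii mulr0.
- rewrite q'S ?ii//.
  have := @umbral_extremal k (i - k) (leqnn _).
  rewrite subnn vtx0 (_ : (_ == i0) = false); last by lia.
  rewrite mulr0 mulrC umbral_binomial big_ord_recl bin0 subn0 -exprD !mul1r umbralXn.
  rewrite subnK; last by lia.
  move=> /(canRL (addrK _)); rewrite sub0r => ->.
  rewrite big_add1/= big_mkord -sumrN; apply: eq_bigr => j _.
  have jk := ltn_ord j; rewrite -exprD umbralXn IH; [|lia|lia].
  have -> : (i - k + (k - bump 0 j) = i - j.+1)%N by rewrite /bump; lia.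
  by rewrite [bump 0 j]add1n exprS; ring.
- by rewrite q'g /q /vtx leqnn subnn bin0 mulr1.
Qed.

End Extremal.

(** * Symmetrization over the permutations of the coordinates *)

Section Averaging.
Variables (R : realType) (d : nat) (f : {set 'I_d} -> R).
Implicit Types (A S T W : {set 'I_d}).

Lemma imset_subE (s : 'S_d) S A : (s @: S \subset s @: A) = (S \subset A).
Proof.
apply/idP/idP => [/fintype.subsetP sub|]; last exact: imsetS.
apply/fintype.subsetP => x xS; have := sub _ (imset_f s xS).
by rewrite mem_imset//; exact: perm_inj.
Qed.

Definition average W : R := (d`!)%:R^-1 * \sum_(s : 'S_d) f (s @: W).

Lemma average_perm (t : 'S_d) W : average (t @: W) = average W.
Proof.
rewrite /average; congr (_ * _).
rewrite [RHS](reindex_inj (mulgI t)); apply: eq_bigr => s _ /=.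
by rewrite -imset_comp; congr f; apply: eq_imset => x; rewrite /= permM.
Qed.

(** A transposition exchanging a point of [W :\: W'] with one of [W' :\: W] preserves the average
    and brings [W] closer to [W']. *)
Lemma average_card W W' : #|W| = #|W'| -> average W = average W'.
Proof.
have [n] := ubnP #|W :\: W'|; elim: n W => // n IH W lt_n WW'.
have [|[x xWW']] := set_0Vmem (W :\: W').
  move=> /eqP; rewrite finset.setD_eq0 => sub; congr average; apply/eqP.
  by rewrite eqEcard sub WW'/=.
have [|[y yW'W]] := set_0Vmem (W' :\: W).
  move=> /eqP; rewrite finset.setD_eq0 => sub; congr average; apply/esym/eqP.
  by rewrite eqEcard sub WW'/=.
rewrite -(average_perm (tperm x y)); apply: IH; last first.
  by rewrite card_imset//; exact: perm_inj.
move: xWW' yW'W; rewrite !inE => /andP[xW' xW] /andP[yW yW'].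
rewrite -ltnS (leq_trans _ lt_n)// ltnS; apply: proper_card.
apply/properP; split.
  apply/fintype.subsetP => z; rewrite !inE => /andP[zW' /imsetP[w wW zE]].
  move: zW' wW; rewrite {}zE; case: tpermP => [->|->|_ _] zW' wW.
  - by rewrite yW' in zW'.
  - by rewrite wW in yW.
  - by rewrite zW'.
exists x; first by rewrite !inE xW' xW.
rewrite !inE negb_and; apply/orP; right; apply/imsetP => -[w wW].
move=> /(congr1 (tperm x y)); rewrite tpermK tpermL => yw.
by rewrite yw wW in yW.
Qed.

(** The sets record lower coordinates; for [i <= d] this representative has [d - i] of them, so that
    [i] counts the upper ones as in q_i. *)
Definition profile i : R := average [set x in drop i (enum 'I_d)].

Lemma average_profile W : average W = profile (d - #|W|).
Proof.
apply: average_card; rewrite cardsE (card_uniqP (drop_uniq _ (enum_uniq _))).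
by rewrite size_drop size_enum_ord subKn// -[leqRHS]card_ord max_card.
Qed.

Lemma sum_subsets_card A (F : nat -> R) :
  \sum_(S : {set 'I_d} | S \subset A) F #|S| =
  \sum_(j < #|A|.+1) 'C(#|A|, j)%:R * F j.
Proof.
rewrite (partition_big (fun S => inord #|S| : 'I_#|A|.+1) predT)//=.
apply: eq_bigr => j _; rewrite -cards_draws cardsE mulr_natl -sumr_const.
apply: eq_big => [S|S]; last first.
  by move=> /andP[/subset_leq_card SA /eqP <-]; rewrite inordK.
rewrite unfold_in/=; case SA: (S \subset A) => //=.
by rewrite -val_eqE/= inordK// ltnS subset_leq_card.
Qed.

(** Grouping subsets of [A] by size turns the binomial expansion into an alternating sum over the
    vertices of a face with free coordinates [A], lower ones [T] and all others upper. Differences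
    of the profile are thus means of section volumes. *)
Lemma difference_profile A T : [disjoint A & T]%B ->
  umbral profile (('X - 1) ^+ #|A| * 'X^(d - #|A| - #|T|)) =
  (d`!)%:R^-1 * \sum_(s : 'S_d)
    \sum_(S : {set 'I_d} | S \subset s @: A) (-1) ^+ #|S| * f (S :|: s @: T).
Proof.
move=> dAT.
have ATd : (#|A| + #|T| <= d)%N.
  have := leq_card_setU A T; rewrite dAT => /leqifP; rewrite ?eqxx => /eqP <-.
  by rewrite -[X in (_ <= X)%N]card_ord max_card.
transitivity (\sum_(S : {set 'I_d} | S \subset A) (-1) ^+ #|S| * average (S :|: T)).
  pose F n := (-1) ^+ n * profile (d - n - #|T|).
  rewrite mulrC umbral_binomial.
  transitivity (\sum_(S : {set 'I_d} | S \subset A) F #|S|).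
    rewrite sum_subsets_card; apply: eq_bigr => j _.
    rewrite -exprD umbralXn /F [RHS]mulrCA -mulrA; congr (_ * (_ * profile _)).
    by have := ltn_ord j; lia.
  apply: eq_bigr => S SA; rewrite average_profile /F; congr (_ * profile _).
  have := leq_card_setU S T; rewrite (disjointWl SA dAT) => /leqifP.
  by rewrite ?eqxx => /eqP->; rewrite subnDA.
have pullback (s : 'S_d) : \sum_(S : {set 'I_d} | S \subset s @: A)
      (-1) ^+ #|S| * f (S :|: s @: T) =
    \sum_(S : {set 'I_d} | S \subset A) (-1) ^+ #|S| * f (s @: (S :|: T)).
  rewrite (reindex_inj (imset_inj (@perm_inj _ s)))/=.
  apply: eq_big => [S|S _]; first exact: imset_subE.
  by rewrite card_imset ?imsetU//; exact: perm_inj.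
rewrite (eq_bigr _ (fun s _ => pullback s)).
rewrite /= exchange_big/= mulr_sumr; apply: eq_bigr => S _.
by rewrite /average mulrCA mulr_sumr.
Qed.

End Averaging.

(** * Section volumes and the lower bound *)

Lemma section_volume (R : realType) (I : finType) (F : (I -> R) -> R)
    (A : {set I}) (c a b : I -> R) :
  volume (section F c) (fun j : {j | j \in A} => a (val j))
    (fun j : {j | j \in A} => b (val j)) =
  \sum_(S : {set I} | S \subset A)
    (-1) ^+ #|S| * F (fun i => if i \in A then vertex a b S i else c i).
Proof.
pose emb (S : {set {j | j \in A}}) : {set I} := val @: S.
pose res (S : {set I}) : {set {j | j \in A}} := [set j | val j \in S]%SET.
have embK S : res (emb S) = S.
  by apply/setP => j; rewrite inE mem_imset//; exact: val_inj.
rewrite (reindex_onto emb res) => [|S SA]; last first.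
  apply/setP => i; apply/imsetP/idP => [[j]|iS]; first by rewrite inE => jS ->.
  have iA : i \in A by apply: (fintype.subsetP SA).
  by exists (Sub i iA); rewrite ?inE SubK.
apply: eq_big => [S|S _].
  rewrite embK eqxx andbT; apply/esym/fintype.subsetP => i /imsetP[j _ ->].
  exact: valP.
rewrite card_imset; last exact: val_inj.
congr (_ * F _); apply: funext => i; rewrite /Defs.glue.
case: (insubP {j | j \in A} i) => [j iA <-|/negbTE->//].
by rewrite (valP j) /vertex mem_imset//; exact: val_inj.
Qed.

Lemma exists_superset (T : finType) (A : {set T}) k : (#|A| <= k <= #|T|)%N ->
  exists2 B : {set T}, A \subset B & #|B| = k.
Proof.
move=> /andP[]; have [n] := ubnP (k - #|A|); elim: n A => // n IH A lt_n.
rewrite leq_eqVlt => /orP[/eqP Ak|Ak] kT; first by exists A.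
have [|[x xA]] := set_0Vmem (~: A)%SET.
  by move=> /eqP; rewrite -cards_eq0 cardsCs finset.setCK; lia.
rewrite inE in xA; have Ax : #|x |: A| = #|A|.+1 by rewrite cardsU1 xA.
have [|||B AB Bk] := IH (x |: A); rewrite ?Ax//; first by lia.
by exists B => //; apply: fintype.subset_trans AB; exact: finset.subsetUr.
Qed.

Section LowerBound.
Variables (R : realType) (d k : nat) (Q : ('I_d -> R) -> R) (a b : 'I_d -> R).
Hypotheses (k_gt1 : (1 < k)%N) (k_le_d : (k <= d)%N).
Hypotheses (qcQ : quasi_copula Q) (kQ : k_increasing k (cube0 R d) (cube1 R d) Q).
Hypothesis ab : subbox (cube0 R d) (cube1 R d) a b.

Let f (S : {set 'I_d}) : R := Q (vertex a b S).

Let ab_bounds i : [/\ 0 <= a i, a i <= b i & b i <= 1].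
Proof. by have /and3P := ab i. Qed.

Lemma vertex_in_cube S : in_cube (vertex a b S).
Proof.
move=> i; have [a0 ab1 b1] := ab_bounds i; rewrite /vertex.
case: ifP => _; first by rewrite a0 (le_trans ab1).
by rewrite b1 (le_trans a0).
Qed.

(* Q is j-increasing for j <= k too: add k - j coordinates ranging over boxes
   [0, t]; by groundedness only their upper ends contribute. *)
Lemma section_ge0 (A T : {set 'I_d}) : (#|A| <= k)%N -> [disjoint A & T]%B ->
  0 <= \sum_(S : {set 'I_d} | S \subset A) (-1) ^+ #|S| * f (S :|: T).
Proof.
move=> Ak dAT; have [|B AB Bk] := @exists_superset _ A k.
  by rewrite Ak card_ord.
pose c := vertex a b T.
pose a' i := if i \in A then a i else 0.
have cE i : i \in A -> c i = b i.
  by move=> iA; rewrite /c /vertex (disjointFr dAT iA).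
have a'c i : [/\ 0 <= a' i, a' i <= c i & c i <= 1].
  have /andP[c0 c1] := vertex_in_cube T i; split => //; rewrite /a'.
    by case: ifP => // _; have [] := ab_bounds i.
  by case: ifP => // iA; rewrite cE//; have [] := ab_bounds i.
have /(kQ Bk (fun j _ => vertex_in_cube T j)) :
    subbox (fun j : {j | j \in B} => cube0 R d (val j))
      (fun j => cube1 R d (val j)) (fun j => a' (val j)) (fun j => c (val j)).
  by move=> j; have [? ? ?] := a'c (val j); exact/and3P.
rewrite section_volume.
rewrite (bigID (fun S : {set 'I_d} => S \subset A))/=.
rewrite [X in _ + X]big1 ?addr0 => [|S]; last first.
  move=> /andP[SB /subsetPn[i iS iA]]; rewrite (qc_grounded qcQ) ?mulr0//.
    move=> j; have [? ac c1] := a'c j; rewrite /vertex; case: ifP => _.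
      by case: ifP => _; apply/andP; split => //; [exact: le_trans c1|exact: le_trans ac].
    exact: vertex_in_cube.
  exists i; rewrite (fintype.subsetP SB)// /vertex iS /a'.
  by rewrite (negbTE iA).
congr (0 <= _); apply: eq_big => [S|S /andP[SB SA]].
  by rewrite andb_idl// => SA; exact: fintype.subset_trans SA AB.
congr (_ * Q _); apply: funext => i; rewrite /vertex inE.
case: ifP => iB.
  case: ifP => iS /=.
    by rewrite /a' (fintype.subsetP SA).
  by [].
suff -> : (i \in S) = false by [].
by apply/negP => /(fintype.subsetP SA)/(fintype.subsetP AB); rewrite iB.
Qed.

Let q := profile f.

Lemma profile_ge0 j s : (j <= k)%N -> (j + s <= d)%N ->
  0 <= umbral q (('X - 1) ^+ j * 'X^s).
Proof.
move=> jk jsd.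
have [|A _ Aj] := @exists_superset 'I_d finset.set0 j.
  by rewrite cards0 card_ord; lia.
(* The [s] points of [B] outside [A] are the upper coordinates, and the complement of [B] gives the
   fixed lower ones. *)
have [|B AB Bj] := @exists_superset 'I_d A (j + s).
  by rewrite Aj card_ord leq_addr.
have dAB : [disjoint A & ~: B]%B by rewrite finset.disjoints_subset finset.setCK.
have Bs : s = (d - #|A| - #|~: B|)%N.
  by have := cardsC B; rewrite card_ord Aj Bj; lia.
rewrite Bs -{1}Aj difference_profile// mulr_ge0 ?invr_ge0// sumr_ge0// => t _.
apply: section_ge0; first by rewrite card_imset ?Aj//; exact: perm_inj.
rewrite -finset.setI_eq0 -imsetI => [|x y _ _]; last exact: perm_inj.
by rewrite (finset.disjoint_setI0 dAB) imset0.
Qed.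

Lemma mean_perm_const (x : R) : (d`!)%:R^-1 * (\sum_(s : 'S_d) x) = x.
Proof.
rewrite sumr_const card_Sn -[x *+ _]mulr_natl mulKf// pnatr_eq0.
by rewrite -lt0n fact_gt0.
Qed.

Lemma profile_le1 : q d <= 1.
Proof.
have <- : average f finset.set0 = q d by rewrite average_profile cards0 subn0.
rewrite /average (eq_bigr (fun=> f finset.set0)) => [|s _]; last by rewrite imset0.
by rewrite mean_perm_const; have /andP[] := qc_range qcQ (vertex_in_cube finset.set0).
Qed.

(** With every coordinate free, all permutations contribute the same volume, so averaging loses
    nothing. *)
Lemma volume_profile : volume Q a b = umbral q (('X - 1) ^+ d).
Proof.
have := @difference_profile R d f [set: 'I_d]%SET finset.set0.
rewrite cardsT card_ord cards0 subnn mulr1 => ->; last first.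
  by rewrite -finset.setI_eq0 finset.setI0.
rewrite -[LHS]mean_perm_const; congr (_ * _); apply: eq_bigr => s _.
rewrite imset0; apply: eq_big => [S|S _]; last by rewrite finset.setU0.
apply/esym/fintype.subsetP => x _; rewrite -[x](permKV s).
by rewrite imset_f// inE.
Qed.

(** Taylor's formula is applied to [q d <= 1]: the differences of order below [k] at 0 are
    nonnegative and are dropped, and the binomials of the remainder are the gammas. *)
Lemma gamma_profile_le1 :
  \sum_(i < (d - k).+1) (gamma d k (d - i))%:R *
    umbral q (('X - 1) ^+ k * 'X^(d - k - i)) <= 1.
Proof.
apply: le_trans profile_le1; rewrite -(umbralXn q d) (Xn_taylor _ d k.-1).
rewrite linearD !linear_sum/= prednK; last by lia.
rewrite -[leLHS]add0r lerD//.
  apply: sumr_ge0 => j _; rewrite linearMn/= mulrn_wge0//.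
  by rewrite -[_ ^+ j]mulr1 -(expr0 'X) profile_ge0//; have := ltn_ord j; lia.
rewrite -(big_mkord xpredT (fun s => umbral q
  (('X - 1) ^+ k * 'X^s *+ 'C(d - s.+1, k.-1)))).
rewrite (@big_cat_nat _ _ _ (d - k).+1)/=; [|by []|by lia].
rewrite [X in _ <= _ + X]big_nat_cond [X in _ <= _ + X]big1 ?addr0 => [|s]; last first.
  by move=> /andP[? _]; rewrite bin_small ?mulr0n ?linear0//; lia.
(* The substitution [s = d - k - i] turns ['C(d - s.+1, k.-1)] into [gamma d k (d - i)]. *)
rewrite big_nat_rev big_mkord/= le_eqVlt; apply/orP; left; apply/eqP.
apply: eq_bigr => i _; have id := ltn_ord i; rewrite linearMn/= -[RHS]mulr_natl.
rewrite add0n subSS gammaE; [|lia|lia].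
by congr (_%:R * _); congr ('C(_, _)); lia.
Qed.

(** Weak linear programming duality: as [M <= 0], it is at most [M] times the gamma-weighted sum,
    and this is compared with the volume coefficient by coefficient. *)
Lemma volume_ge (M : R) : M <= 0 ->
  (forall i, (k <= i <= d)%N -> M <= mnv_term R d k i) -> M <= volume Q a b.
Proof.
move=> M0 Mterm; rewrite volume_profile -{1}(subnKC k_le_d) exprD umbral_binomial.
have : M <= M * \sum_(i < (d - k).+1) (gamma d k (d - i))%:R *
    umbral q (('X - 1) ^+ k * 'X^(d - k - i)).
  by rewrite -{1}[M]mulr1 ler_wnM2l// gamma_profile_le1.
move=> /le_trans; apply; rewrite mulr_sumr ler_sum// => i _.
have id := ltn_ord i; rewrite mulrA ler_wpM2r ?profile_ge0//; first by lia.
have gt0 : 0 < (gamma d k (d - i))%:R :> R by rewrite ltr0n gamma_gt0//; lia.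
rewrite -ler_pdivlMr//; apply: le_trans (Mterm (d - i)%N _) _; first by lia.
rewrite /mnv_term subKn; last by lia.
rewrite -bin_sub; last by lia.
rewrite le_eqVlt; apply/orP; left; apply/eqP.
by congr (_ * (_%:R) * _); congr ('C(_, _)); lia.
Qed.

End LowerBound.

(** * Attaining the value 0, and assembly of the result *)

Lemma umbral1 (R : realType) (p : {poly R}) : umbral (fun=> 1) p = p.[1].
Proof. by rewrite horner_coef; apply: eq_bigr => i _; rewrite expr1n. Qed.

(** Provides a member of the class when all terms are positive and the minimum 0 has to be attained.
    For [q] constantly 1 the functional is evaluation at 1, where [node t t] equals [t]. *)
Lemma product_copula (R : realType) d k : (1 < k)%N ->
  exists2 Q : ('I_d -> R) -> R, quasi_copula Q &
    k_increasing k (cube0 R d) (cube1 R d) Q.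
Proof.
move=> k_gt1; have q_cone : cone (fun=> 1 : R) k 0 1.
  by move=> j s _; rewrite umbral1 !hornerE subrr expr1n mulr1 exprn_ge0.
exists (@blend R (fun=> 1) id id 'I_d).
  by apply: (@quasi_copula_blend _ _ _ _ k) => // t _; rewrite subrr mul0r add0r.
exact: k_increasing_blend.
Qed.

Lemma volume_degenerate (R : realType) (I : finType) (F : (I -> R) -> R) a :
  (0 < #|I|)%N -> volume F a a = 0.
Proof.
move=> I0; have aS S : vertex a a S = a by apply: funext => i; rewrite /vertex if_same.
rewrite /volume; under eq_bigr do rewrite aS.
rewrite -mulr_suml (_ : \sum_S _ = \prod_(i : I) (-1 + 1 : R)).
  by rewrite addNr prodr_const expr0n gtn_eqF// mul0r.
rewrite bigA_distr; apply: eq_bigr => S _.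
by rewrite -prodr_const big_mkcond.
Qed.

Theorem theorem1 (R : realType) (d k : nat) (hkd : (2 <= k <= d)%N) :
  [/\ is_minimum (kqc_volumes R d k) (MNV R d k),
      MNV R d k = Num.min 0
        (\big[Num.min/mnv_term R d k k]_(k <= i < d.+1) mnv_term R d k i) &
      forall i0 : nat, (k <= i0 <= d)%N -> MNV R d k = mnv_term R d k i0 ->
      forall a : R, a = 1 - (alpha d k i0)%:R / (gamma d k i0)%:R ->
      forall q : nat -> R, is_vertex_values d k i0 q ->
      subbox (cube0 R d) (cube1 R d) (fun=> a) (fun=> 1) /\
      exists Q : ('I_d -> R) -> R,
        [/\ quasi_copula Q,
            k_increasing k (cube0 R d) (cube1 R d) Q,
            forall z : 'I_d -> R, (forall i, z i = a \/ z i = 1) ->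
              Q z = q (d - #|[set i | z i == a]%SET|)%N &
            volume Q (fun=> a) (fun=> 1) = MNV R d k]].
Proof.
have /andP[k_gt1 k_le_d] := hkd.
(* The term at [i = d] is positive, so an index whose term is at most 0 lies strictly below [d]. *)
have term_lt i : (k <= i <= d)%N -> mnv_term R d k i <= 0 -> (i < d)%N.
  move=> /andP[ki]; rewrite leq_eqVlt => /orP[/eqP->|//].
  rewrite /mnv_term subnn binn !mul1r leNgt invr_gt0 ltr0n => /negP[].
  by rewrite gamma_gt0// k_gt1.
set m := \big[_/_]_(_ <= _ < _) _.
have m_le i : (k <= i <= d)%N -> m <= mnv_term R d k i.
  by move=> kid; apply: ge_bigmin_seq; rewrite // mem_index_iota.
have [i1 i1_range mE] : exists2 i, (k <= i <= d)%N & m = mnv_term R d k i.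
  rewrite /m big_nat_cond.
  elim/big_rec: _ => [|i x /andP[i_range _] [j j_range ->]].
    by exists k; rewrite ?leqnn.
  by rewrite minElt; case: ifP => _; [exists i|exists j].
have box_a i : (k <= i < d)%N -> subbox (cube0 R d) (cube1 R d)
    (fun=> 1 - (alpha d k i)%:R / (gamma d k i)%:R) (fun=> 1).
  move=> /andP[ki id] j; rewrite lexx andbT.
  by rewrite !ltW// ?(corner_gt0 _ k_gt1 ki id) ?(corner_lt1 _ k_gt1 ki id).
have lower : lbound (kqc_volumes R d k) (Num.min 0 m).
  move=> _ [Q [a [b [qcQ kQ ab ->]]]]; apply: (volume_ge k_gt1 k_le_d) => //.
    by rewrite ge_min lexx.
  by move=> i i_range; rewrite ge_min m_le ?orbT.
have attained : kqc_volumes R d k (Num.min 0 m).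
  have [m0|m0] := leP m 0.
    have i1_range' : (k <= i1 < d)%N.
      by have /andP[-> _] := i1_range; rewrite term_lt// -mE.
    have /andP[ki1 i1d] := i1_range'.
    have [qcQ kQ] := extremal_spec R k_gt1 ki1 i1d.
    exists (extremal k i1), (fun=> 1 - (alpha d k i1)%:R / (gamma d k i1)%:R), (fun=> 1).
    split; [by []|by []|exact: box_a|].
    by rewrite extremal_volume// min_r// mE.
  (* When every term is positive the minimum is 0, realized on a degenerate box. *)
  have [Q qcQ kQ] := product_copula R d k_gt1.
  exists Q, (fun=> 1), (fun=> 1); split => //.
    by move=> i; rewrite lexx ler01.
  by rewrite volume_degenerate// card_ord; lia.
have MNVE : MNV R d k = Num.min 0 m.
  apply/le_anti/andP; split; last by apply: lb_le_inf => //; exists (Num.min 0 m).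
  by apply: ge_inf => //; exists (Num.min 0 m).
split; rewrite ?MNVE//.
move=> i0 i0_range i0E _ -> q qE.
(* As [MNV] is at most 0, [i0 = d] is excluded; there the corner [a] would be 0 and [ramp_m] would
   degenerate. *)
have i0_lt : (k <= i0 < d)%N.
  have /andP[-> _] := i0_range.
  by rewrite term_lt// -i0E ge_min lexx.
have /andP[ki0 i0d] := i0_lt; have [qcQ kQ] := extremal_spec R k_gt1 ki0 i0d.
split; first exact: box_a.
exists (extremal k i0); split => //.
  move=> z za; rewrite (vertex_valuesE k_gt1 ki0 i0d qE) ?leq_subr//.
  exact: extremal_vertex.
by rewrite i0E extremal_volume.
Qed.
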